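(* Let $D$ be a signed digraph on $[n]$ and $s\ge2$, and let \[ \phi:=\max_{0\le i\le n-1}\min\left\{\frac{n-d_i^0+1}{2},\ n-d_i^0-d_i^-+1,\ n-d_i^0-d_i^++1\right\}. \] Every code $\mathcal C\subseteq[s]^n$ with $d_{\mathrm m}(c,c')\ge\phi$ for all distinct $c,c'\in\mathcal C$ is a subset of $\mathrm{Fix}(f)$ for some $f\in F(D,s)$. Thus \[ g(D,s)\ge\log_s A_{\mathrm m}(n,\phi,s), \] and in particular \[ g(D,2)\ge\log_2 A_{\mathrm m}(n,\phi,2)\ge\log_2 A_{\mathrm H}(n,2\phi,\lfloor n/2\rfloor,2). \]
   Context: A signed digraph on $[n]=\{0,\dots,n-1\}$ is $D=([n],E,\lambda)$ with $E\subseteq[n]\times[n]$ (loops allowed) and $\lambda:E\to\{-1,0,1\}$. For $i\in[n]$, $N^\alpha(i)=\{j:(j,i)\in E,\lambda(j,i)=\alpha\}$, $N(i)$ is their union, and $d_i^0=|N^0(i)|$, $d_i^+=|N^{1}(i)|$, $d_i^-=|N^{-1}(i)|$. $[s]=\{0,\dots,s-1\}$. $F(D,s)$ is the set of maps $f:[s]^n\to[s]^n$ such that each $f_i$ depends only on $x_{N(i)}$, is non-decreasing in $x_j$ when $\lambda(j,i)=1$ and non-increasing in $x_j$ when $\lambda(j,i)=-1$; $\mathrm{Fix}(f)$ is its set of fixed points, $g(D,s)=\max_{f\in F(D,s)}\log_s|\mathrm{Fix}(f)|$. For $x,y\in[s]^n$, $L(x,y)=|\{i:x_i<y_i\}|$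 and $d_{\mathrm m}(x,y)=\min\{L(x,y),L(y,x)\}$. $A_{\mathrm m}(n,d,s)$ is the maximum cardinality of $\mathcal C\subseteq[s]^n$ with $d_{\mathrm m}(c,c')\ge d$ for all distinct $c,c'\in\mathcal C$. $A_{\mathrm H}(n,d,w,2)$ is the maximum cardinality of a set $\mathcal C\subseteq\{0,1\}^n$ all of whose elements have exactly $w$ ones and whose distinct elements differ in at least $d$ coordinates. *)

(* Defs.v *)
From mathcomp Require Import all_boot all_order all_algebra.
From mathcomp Require Import reals exp.

Set Implicit Arguments.
Unset Strict Implicit.
Unset Printing Implicit Defensive.

Import Order.TTheory GRing.Theory Num.Theory.

Local Open Scope ring_scope.

(* [label] is a total function, but only its values on [arcs] are constrained,
   and only those are ever used. *)
Record sdigraph (n : nat) := SDigraph {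
  arcs : {set 'I_n * 'I_n};
  label : 'I_n * 'I_n -> int;
  labelP : forall e, e \in arcs -> label e \in [:: -1; 0; 1]
}.

Notation word n s := {ffun 'I_n -> 'I_s}.

Section SignedDigraph.

Variables (n : nat) (D : sdigraph n).

Definition nbr (a : int) (i : 'I_n) : {set 'I_n} :=
  [set j | ((j, i) \in arcs D) && (label D (j, i) == a)].

Definition nbrs (i : 'I_n) : {set 'I_n} := nbr (-1) i :|: nbr 0 i :|: nbr 1 i.

Definition deg (a : int) (i : 'I_n) : nat := #|nbr a i|.

(* The subtractions are in [rat]: nothing is truncated, and phi may be a
   half-integer. Every term of the maximum is at least 1/2, so the default
   value 0 of the iterated maximum matters only when n = 0. *)
Definition phi : rat :=
  \big[Num.max/0]_(i < n)
    Num.min ((n%:R - (deg 0 i)%:R + 1) / 2)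
      (Num.min (n%:R - (deg 0 i)%:R - (deg (-1) i)%:R + 1)
               (n%:R - (deg 0 i)%:R - (deg 1 i)%:R + 1)).

Section Maps.

Variable s : nat.

Implicit Type f : {ffun word n s -> word n s}.

Definition depends_only f (i : 'I_n) (A : {set 'I_n}) : bool :=
  [forall x : word n s, forall y : word n s,
    [forall j in A, x j == y j] ==> (f x i == f y i)].

Definition differ_at_most (j : 'I_n) (x y : word n s) : bool :=
  [forall k : 'I_n, (k != j) ==> (x k == y k)].

Definition nondecreasing_in f (i j : 'I_n) : bool :=
  [forall x : word n s, forall y : word n s,
    differ_at_most j x y && (x j <= y j)%N ==> (f x i <= f y i)%N].

Definition nonincreasing_in f (i j : 'I_n) : bool :=
  [forall x : word n s, forall y : word n s,
    differ_at_most j x y && (x j <= y j)%N ==> (f y i <= f x i)%N].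

Definition sdmaps : {set {ffun word n s -> word n s}} :=
  [set f | [forall i : 'I_n,
    [&& depends_only f i (nbrs i),
        [forall j in nbr 1 i, nondecreasing_in f i j] &
        [forall j in nbr (-1) i, nonincreasing_in f i j]]]].

Definition fixpts f : {set word n s} := [set x | f x == x].

End Maps.

End SignedDigraph.

Definition logb (R : realType) (s a : nat) : R := ln a%:R / ln s%:R.

(* For s >= 2 the constant maps lie in [sdmaps D s] and have exactly one fixed
   point, so they contribute log_s 1 = 0 to the maximum. Hence neither the
   default value 0 of the iterated maximum, nor the library convention
   ln 0 = 0 (where log_s 0 should be -oo) for maps without fixed points,
   changes the value. *)
Definition guess (R : realType) (n : nat) (D : sdigraph n) (s : nat) : R :=
  \big[Num.max/0]_(f in sdmaps D s) logb R s #|fixpts f|.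

Section Codes.

Variables n s : nat.

Definition Lcount (x y : word n s) : nat := #|[set i | (x i < y i)%N]|.

Definition dm (x y : word n s) : nat := minn (Lcount x y) (Lcount y x).

Definition dH (x y : word n s) : nat := #|[set i | x i != y i]|.

Definition min_dist_ge (dist : word n s -> word n s -> nat) (d : rat)
    (C : {set word n s}) : bool :=
  [forall c in C, forall c' in C, (c != c') ==> (d <= (dist c c')%:R)].

End Codes.

Definition weight (n : nat) (x : word n 2) : nat := #|[set i | x i == 1%N :> nat]|.

Definition Am (n : nat) (d : rat) (s : nat) : nat :=
  \max_(C : {set word n s} | min_dist_ge (@dm n s) d C) #|C|.

Definition AH2 (n : nat) (d : rat) (w : nat) : nat :=
  \max_(C : {set word n 2} |
        [forall c in C, weight c == w] && min_dist_ge (@dH n 2) d C) #|C|.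

(* Main.v *)
Require Import Defs.
From mathcomp Require Import all_boot all_order all_algebra.
From mathcomp Require Import reals exp.
From mathcomp Require Import zify lra.

(** Given a code C, let f_i(x) be the largest c_i over the c in C lying below x
    for the preorder that asks for equality on N^0(i), c <= x on N^+(i) and
    c >= x on N^-(i). Such an f is in F(D,s), and it fixes c unless some c' in C
    lies below c with c'_i > c_i. But then {c' < c} avoids N^0 and N^-, {c < c'}
    avoids N^0 and N^+, and both sets are disjoint, so d_m(c,c') is smaller than
    the i-th term of phi. Between binary words of equal weight, d_H = 2 d_m. *)

Set Implicit Arguments.
Unset Strict Implicit.
Unset Printing Implicit Defensive.

Import Order.TTheory GRing.Theory Num.Theory.

Local Open Scope ring_scope.

Section SignedPreorder.

Variables (n : nat) (D : sdigraph n) (s : nat).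

Implicit Types (x y z : word n s) (i j : 'I_n).

Definition below i x y : bool :=
  [&& [forall j in nbr D 0 i, x j == y j],
      [forall j in nbr D 1 i, (x j <= y j)%N] &
      [forall j in nbr D (-1) i, (y j <= x j)%N]].

Lemma belowP i x y :
  reflect [/\ {in nbr D 0 i, x =1 y},
              {in nbr D 1 i, forall j, (x j <= y j)%N} &
              {in nbr D (-1) i, forall j, (y j <= x j)%N}]
          (below i x y).
Proof.
apply: (iffP and3P) => [[/forall_inP h0 /forall_inP h1 /forall_inP hN]|[h0 h1 hN]].
  split=> [j /h0/eqP||]; [by [] | exact: h1 | exact: hN].
by split; apply/forall_inP => // j /h0 ->.
Qed.

Lemma below_refl i x : below i x x.
Proof. by apply/belowP; split=> j _. Qed.

Lemma below_trans i y x z : below i x y -> below i y z -> below i x z.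
Proof.
move=> /belowP[xy0 xy1 xyN] /belowP[yz0 yz1 yzN]; apply/belowP; split=> j hj.
- by rewrite xy0 // yz0.
- exact: leq_trans (xy1 j hj) (yz1 j hj).
- exact: leq_trans (yzN j hj) (xyN j hj).
Qed.

Lemma nbrs_nbr a i : a \in [:: -1; 0; 1] -> nbr D a i \subset nbrs D i.
Proof.
rewrite /nbrs !inE => /or3P[]/eqP->.
- exact: subset_trans (subsetUl _ _) (subsetUl _ _).
- exact: subset_trans (subsetUr _ _) (subsetUl _ _).
- exact: subsetUr.
Qed.

Lemma below_eq_in i x y : {in nbrs D i, x =1 y} -> below i x y.
Proof.
move=> xy; apply/belowP; split=> j hj; rewrite xy //;
  by apply: subsetP hj; apply: nbrs_nbr; rewrite !inE eqxx ?orbT.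
Qed.

Lemma nbr_inj a b i j : j \in nbr D a i -> j \in nbr D b i -> a = b.
Proof. by rewrite !inE => /andP[_ /eqP<-] /andP[_ /eqP<-]. Qed.

(** An arc carries a single label, so [j] lies in neither [nbr D 0 i] nor [nbr D (-1) i]; the only
    coordinate that moves is tested in the direction in which it moves. *)
Lemma below_increase i j x y : j \in nbr D 1 i ->
  differ_at_most j x y -> (x j <= y j)%N -> below i x y.
Proof.
move=> jP /forallP xy le_xy.
have xyE k : k != j -> x k = y k by move=> kj; apply/eqP; apply: implyP (xy k) kj.
apply/belowP; split=> k hk; have [kj|/xyE-> //] := eqVneq k j; subst k => //.
- by have := nbr_inj jP hk.
- by have := nbr_inj jP hk.
Qed.

Lemma below_decrease i j x y : j \in nbr D (-1) i ->
  differ_at_most j x y -> (x j <= y j)%N -> below i y x.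
Proof.
move=> jN /forallP xy le_xy.
have xyE k : k != j -> x k = y k by move=> kj; apply/eqP; apply: implyP (xy k) kj.
apply/belowP; split=> k hk; have [kj|/xyE-> //] := eqVneq k j; subst k => //.
- by have := nbr_inj jN hk.
- by have := nbr_inj jN hk.
Qed.

Lemma card_nbrU a b i : a != b -> #|nbr D a i :|: nbr D b i| = (deg D a i + deg D b i)%N.
Proof.
(* The equality case of [leq_card_setU] is disjointness. *)
move=> ab; apply/eqP; rewrite (leq_card_setU (nbr D a i) (nbr D b i)).
by apply/pred0P => j; apply/negP => /andP[ja /(nbr_inj ja)/eqP]; apply/negP.
Qed.

Lemma Lcount_avoid (A : {set 'I_n}) x y :
  {in A, forall j, (y j <= x j)%N} -> (Lcount x y + #|A| <= n)%N.
Proof.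
move=> hA; rewrite -[leqRHS]card_ord -(cardsC A) addnC leq_add2l.
apply: subset_leq_card; apply/subsetP => j; rewrite !inE => xy.
by apply/negP => /hA; rewrite leqNgt xy.
Qed.

Lemma Lcount_sum x y : (Lcount x y + Lcount y x)%N = dH x y.
Proof.
rewrite /dH; have -> : [set j | x j != y j] =
    [set j | (x j < y j)%N] :|: [set j | (y j < x j)%N].
  by apply/setP => j; rewrite !inE -neq_ltn.
apply/esym/eqP; rewrite (leq_card_setU [set j | (x j < y j)%N]).
apply/pred0P => j; rewrite /= !inE.
by case: ltngtP.
Qed.

Lemma dH_avoid (A : {set 'I_n}) x y : {in A, x =1 y} -> (dH x y + #|A| <= n)%N.
Proof.
move=> hA; rewrite -[leqRHS]card_ord -(cardsC A) addnC leq_add2l.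
apply: subset_leq_card; apply/subsetP => j; rewrite !inE.
by apply: contraNN => /hA ->.
Qed.

(** The [+ 1] in each entry of the i-th minimum turns the integer bounds [h0], [hN], [h1] into
    strict ones, and that minimum is at most [phi D]. *)
Lemma dm_below_lt_phi i x y : below i x y -> (dm x y)%:R < phi D.
Proof.
move=> /belowP[xy0 xy1 xyN]; apply: lt_le_trans (le_bigmax_cond _ _ (erefl true) : _ <= phi D).
have h0 : (dH x y + deg D 0 i <= n)%N by apply: dH_avoid.
(* [x] and [y] agree on N^0(i) and [y <= x] on N^-(i), so no coordinate there counts for
   [Lcount x y]; [h1] is the mirror image. *)
have hN : (Lcount x y + (deg D 0 i + deg D (-1) i) <= n)%N.
  rewrite -card_nbrU //; apply: Lcount_avoid => j /setUP[/xy0->//|]; exact: xyN.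
have h1 : (Lcount y x + (deg D 0 i + deg D 1 i) <= n)%N.
  rewrite -card_nbrU //; apply: Lcount_avoid => j /setUP[/xy0->//|]; exact: xy1.
have hL := geq_minl (Lcount x y) (Lcount y x).
have hR := geq_minr (Lcount x y) (Lcount y x).
rewrite -Lcount_sum in h0; rewrite -/(dm x y) in hL hR.
have {}h0 : (dm x y + dm x y + deg D 0 i <= n)%N by lia.
have {}hN : (dm x y + (deg D 0 i + deg D (-1) i) <= n)%N by lia.
have {}h1 : (dm x y + (deg D 0 i + deg D 1 i) <= n)%N by lia.
move: h0 hN h1; rewrite -!(ler_nat rat) !natrD !lt_min => h0 hN h1.
by apply/and3P; split; lra.
Qed.

End SignedPreorder.

Section CodeMap.

Variables (n : nat) (D : sdigraph n) (s : nat) (C : {set word n s.+1}).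

Implicit Types (x y c : word n s.+1) (i : 'I_n).

(** The maximum is taken in [nat], where it is 0 if no codeword lies below [x]; the alphabet size
    [s.+1] makes 0 a letter. *)
Definition upmax i x : nat := \max_(c in C | below D i c x) c i.

Definition codemap : {ffun word n s.+1 -> word n s.+1} :=
  [ffun x => [ffun i => inord (upmax i x)]].

Lemma codemapE x i : codemap x i = upmax i x :> nat.
Proof.
rewrite !ffunE inordK // ltnS; apply/bigmax_leqP => c _.
by rewrite -ltnS.
Qed.

(** By transitivity, every codeword below [x] also competes at [y]. *)
Lemma leq_upmax i x y : below D i x y -> (upmax i x <= upmax i y)%N.
Proof.
move=> xy; apply/bigmax_leqP => c /andP[cC cx].
by apply: (bigop.bigmax_sup c); rewrite ?cC ?(below_trans cx xy).
Qed.

(** All three conditions are monotonicity of [upmax i] for the preorder; words that agree on N(i)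
    are below each other. *)
Lemma codemap_sdmaps : codemap \in sdmaps D s.+1.
Proof.
rewrite inE; apply/forallP => i; apply/and3P; split.
- apply/forallP => x; apply/forallP => y; apply/implyP => /forall_inP xy.
  have xyE : {in nbrs D i, x =1 y} by move=> j /xy/eqP.
  rewrite -val_eqE /= !codemapE eqn_leq !leq_upmax //; apply: below_eq_in => // j hj.
  by rewrite xyE.
- apply/forall_inP => j hj; apply/forallP => x; apply/forallP => y.
  apply/implyP => /andP[xy le_xy]; rewrite !codemapE.
  exact: leq_upmax (below_increase hj xy le_xy).
- apply/forall_inP => j hj; apply/forallP => x; apply/forallP => y.
  apply/implyP => /andP[xy le_xy]; rewrite !codemapE.
  exact: leq_upmax (below_decrease hj xy le_xy).
Qed.

Lemma code_sub_fixpts :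
  min_dist_ge (@dm n s.+1) (phi D) C -> C \subset fixpts codemap.
Proof.
move=> /forall_inP hC; apply/subsetP => c cC; rewrite inE; apply/eqP/ffunP => i.
apply/val_inj; rewrite /= codemapE; apply/eqP; rewrite eqn_leq; apply/andP; split.
- apply/bigmax_leqP => c' /andP[c'C c'c].
  have [->//|neq] := eqVneq c' c.
  have /forall_inP/(_ c cC) := hC c' c'C.
  (* A second codeword below [c] would be too close to it, so [c] alone competes at [c]. *)
  by rewrite neq leNgt (dm_below_lt_phi c'c).
- by apply: (bigop.bigmax_sup c); rewrite ?cC ?below_refl.
Qed.

End CodeMap.

Lemma ler_logb (R : realType) (s a b : nat) :
  (0 < s)%N -> (a <= b)%N -> logb R s a <= logb R s b.
Proof.
move=> s0 ab; apply: ler_wpM2r.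
  by rewrite invr_ge0 ln_ge0 // ler1n.
(* Since [ln 0 = 0] by convention, [a = 0] needs [ln b >= 0] instead of monotonicity. *)
case: a ab => [|a] ab.
  case: b ab => [//|b _].
  by rewrite [leLHS]ln0 // ln_ge0 // ler1n.
by rewrite ler_ln ?posrE ?ltr0n ?ler_nat // (leq_trans _ ab).
Qed.

Lemma code_in_fixpts (n s : nat) (D : sdigraph n) (C : {set word n s}) :
  (0 < s)%N -> min_dist_ge (@dm n s) (phi D) C ->
  exists2 f : {ffun word n s -> word n s},
    f \in sdmaps D s & C \subset fixpts f.
Proof.
case: s C => // s C _ hC; exists (codemap D C); first exact: codemap_sdmaps.
exact: code_sub_fixpts.
Qed.

Lemma logb_Am_le_guess (R : realType) (n s : nat) (D : sdigraph n) :
  (0 < s)%N -> logb R s (Am n (phi D) s) <= guess R D s.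
Proof.
(* The empty code is admissible, so the maximum [Am] is attained by some code [C]. *)
move=> s0; have [|C hC AmE] := @eq_bigmax_cond _
    [pred C : {set word n s} | min_dist_ge (@dm n s) (phi D) C] (fun C => #|C|).
  by apply/card_gt0P; exists set0; apply/forall_inP => c; rewrite inE.
have [f fD Cf] := code_in_fixpts s0 hC.
rewrite /Am [X in logb R s X]AmE.
apply: le_trans (le_bigmax_cond _ _ fD); apply: ler_logb => //.
exact: subset_leq_card.
Qed.

(** Both sides count the coordinates where [x] or [y] is 1: for bits, [a < b] + a = max(a, b) =
    [b < a] + b. *)
Lemma weight_Lcount (n : nat) (x y : word n 2) :
  (Lcount x y + weight x = Lcount y x + weight y)%N.
Proof.
have cardE (P : pred 'I_n) : #|[set i | P i]| = (\sum_i P i)%N.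
  by rewrite -sum1dep_card big_mkcond; apply: eq_bigr => i _; case: (P i).
rewrite /Lcount /weight !cardE -!big_split /=.
apply: eq_bigr => i _.
by case: (x i) (y i) => [[|[|//]] ?] [[|[|//]] ?].
Qed.

(** Equal weights make the two [Lcount] values equal, so each is [dm x y], and their sum is
    [dH x y]. *)
Lemma dH_eq_weight (n : nat) (x y : word n 2) :
  weight x = weight y -> dH x y = (2 * dm x y)%N.
Proof. by move=> w; have := weight_Lcount x y; rewrite -Lcount_sum /dm; lia. Qed.

(** A code of constant weight is itself a candidate for [Am]: inside it the Hamming distance is
    twice [dm], and the factor 2 cancels. *)
Lemma AH2_le_Am (n w : nat) (d : rat) : (AH2 n (2 * d) w <= Am n d 2)%N.
Proof.
apply/bigmax_leqP => C /andP[/forall_inP hw /forall_inP hC].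
apply: (bigop.bigmax_sup C) => //.
apply/forall_inP => c cC; apply/forall_inP => c' c'C; apply/implyP => neq.
have /forall_inP/(_ c' c'C)/implyP/(_ neq) := hC c cC.
rewrite dH_eq_weight; last by rewrite (eqP (hw c cC)) (eqP (hw c' c'C)).
by rewrite natrM ler_pM2l.
Qed.

Theorem theorem5 (R : realType) (n s : nat) (D : sdigraph n) (hs : (2 <= s)%N) :
  (forall C : {set word n s}, min_dist_ge (@dm n s) (phi D) C ->
     exists2 f : {ffun word n s -> word n s},
       f \in sdmaps D s & C \subset fixpts f) /\
  logb R s (Am n (phi D) s) <= guess R D s /\
  (logb R 2 (Am n (phi D) 2) <= guess R D 2 /\
   logb R 2 (AH2 n (2 * phi D) n./2) <= logb R 2 (Am n (phi D) 2)).
Proof.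
have s0 : (0 < s)%N by apply: ltnW.
split; first by move=> C; apply: code_in_fixpts.
split; first exact: logb_Am_le_guess.
by split; [apply: logb_Am_le_guess | apply/ler_logb/AH2_le_Am].
Qed.
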